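(* Let $n$ be a positive integer. If $G$ is a connected $n$-vertex graph that is not isomorphic to $K_1$, $K_2$, or $P_3$, then $\mathcal{E}_3^{+}(G)\geq \frac{\sqrt{5}}{2}\,n$.
   Context: All graphs are finite and simple. $K_m$ is the complete graph on $m$ vertices and $P_3$ is the path on $3$ vertices. For an $n$-vertex graph $G$, let $\lambda_1(G)\geq\cdots\geq\lambda_n(G)$ be the eigenvalues (with multiplicity) of its adjacency matrix. The positive $3$-energy of $G$ is $\mathcal{E}^+_3(G)=\sum_{i:\lambda_i(G)>0}|\lambda_i(G)|^3$. *)

(* Defs.v *)
From HB Require Import structures.
From mathcomp Require Import all_boot all_order all_algebra.
From mathcomp Require Import complex polyrcf reals.

Set Implicit Arguments.
Unset Strict Implicit.
Unset Printing Implicit Defensive.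

Import Order.TTheory GRing.Theory Num.Theory.
Local Open Scope ring_scope.

Record sgraph (V : finType) := SGraph {
  adj : rel V;
  adj_sym : symmetric adj;
  adj_irrefl : irreflexive adj }.

Definition connected_graph (V : finType) (G : sgraph V) : Prop :=
  forall x y : V, connect (adj G) x y.

Definition graph_iso (V W : finType) (G : sgraph V) (H : sgraph W) : Prop :=
  exists2 f : V -> W, bijective f & {mono f : x y / adj G x y >-> adj H x y}.

Lemma complete_sym m : symmetric (fun i j : 'I_m => i != j).
Proof. by move=> i j; rewrite eq_sym. Qed.

Lemma complete_irrefl m : irreflexive (fun i j : 'I_m => i != j).
Proof. by move=> i; rewrite eqxx. Qed.

Definition complete_graph m : sgraph 'I_m :=
  SGraph (@complete_sym m) (@complete_irrefl m).

Definition path_adj m : rel 'I_m :=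
  fun i j => (i.+1 == j :> nat) || (j.+1 == i :> nat).

Lemma path_adj_sym m : symmetric (@path_adj m).
Proof. by move=> i j; rewrite /path_adj orbC. Qed.

Lemma path_adj_irrefl m : irreflexive (@path_adj m).
Proof. by move=> i; rewrite /path_adj orbb gtn_eqF. Qed.

Definition path_graph m : sgraph 'I_m :=
  SGraph (@path_adj_sym m) (@path_adj_irrefl m).

Section Spectrum.
Variable R : rcfType.

Definition adjacency_mx (V : finType) (G : sgraph V) : 'M[R]_#|V| :=
  \matrix_(i, j) (adj G (enum_val i) (enum_val j))%:R.

(* The real eigenvalues of [A], each repeated according to its multiplicity as
   a root of the characteristic polynomial, in nonincreasing order. *)
Definition eigenvalues n (A : 'M[R]_n) : seq R :=
  sort >=%R (flatten [seq nseq (mup x (char_poly A)) x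
                     | x <- rootsR (char_poly A)]).

Definition positive_energy (p : nat) (V : finType) (G : sgraph V) : R :=
  \sum_(x <- eigenvalues (adjacency_mx G) | 0 < x) `|x| ^+ p.

Lemma adjacency_mx_sym (V : finType) (G : sgraph V) :
  (adjacency_mx G)^T = adjacency_mx G.
Proof. by apply/matrixP => i j; rewrite !mxE adj_sym. Qed.

Lemma eigenvalues_sorted n (A : 'M[R]_n) : sorted >=%R (eigenvalues A).
Proof. by apply: sort_sorted => x y; exact: le_total. Qed.

Lemma count_eigenvalues n (A : 'M[R]_n) x :
  count_mem x (eigenvalues A) = mup x (char_poly A).
Proof.
have p0 : char_poly A != 0 by rewrite monic_neq0 // char_poly_monic.
rewrite /eigenvalues count_sort count_flatten -map_comp /=.
have /(_ x) := roots_on_rootsR p0; rewrite in_itv /= => rE.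
have rU : uniq (rootsR (char_poly A)) by rewrite uniq_roots.
set p := char_poly A in p0 rE rU *.
have cE y : (count_mem x \o (fun z => nseq (mup z p) z)) y
          = ((y == x) * mup x p)%N.
  by rewrite /= count_nseq /=; case: eqP => [->|].
rewrite (eq_map cE) sumnE big_map -big_distrl /= -big_mkcond /=.
rewrite sum1_count count_uniq_mem // -rE.
by case: rootP => [_|/rootP nr]; rewrite ?mul1n // mul0n mupNroot.
Qed.

Lemma sym_char_poly_split n (A : 'M[R]_n) : A^T = A ->
  exists s : seq R, char_poly A = \prod_(x <- s) ('X - x%:P).
Proof.
move=> As; pose B : 'M[R[i]]_n := map_mx (real_complex R) A.
have Bherm : B \is hermsymmx.
  apply: realsym_hermsym.
    by apply/is_hermitianmxP; rewrite expr0 scale1r map_mx_id // /B map_trmx As.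
  by apply/mxOverP => i j; rewrite mxE complex_real.
have /hermitian_normalmx/orthomx_spectralP BE := Bherm.
have dR := hermitian_spectral_diag_real Bherm.
have PU := spectral_unit B.
move: (spectralmx B) (spectral_diag B) BE dR PU => P d BE /mxOverP dR PU.
exists [seq complex.Re (d 0 i) | i : 'I_n].
apply: (@map_inj_poly _ _ (real_complex R) _ _ _ _ _).
- exact: complexI.
- by rewrite rmorph0.
rewrite map_char_poly -/B rmorph_prod /= big_image /=.
have -> : char_poly B = char_poly (diag_mx d).
  rewrite /char_poly /char_poly_mx {1}BE.
  pose Q := map_mx (@polyC R[i]) P; pose Q' := map_mx (@polyC R[i]) (invmx P).
  have Q'Q : Q' *m Q = 1%:M by rewrite -map_mxM mulVmx // map_mx1.
  have QQ' : Q *m Q' = 1%:M by rewrite -map_mxM mulmxV // map_mx1.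
  have -> : 'X%:M - map_mx polyC (invmx P *m diag_mx d *m P)
          = Q' *m ('X%:M - map_mx polyC (diag_mx d)) *m Q.
    rewrite !map_mxM mulmxBr mulmxBl; congr (_ - _).
    by rewrite mul_mx_scalar -scalemxAl Q'Q scalemx1.
  rewrite !det_mulmx mulrC mulrA -det_mulmx QQ' det1 mul1r //.
rewrite char_poly_trig ?diag_mx_is_trig //; apply: eq_bigr => i _.
rewrite mxE eqxx mulr1n rmorphB /= map_polyX map_polyC /=.
by rewrite (RRe_real (dR 0 i)).
Qed.

(* By the spectral theorem, no eigenvalue of a symmetric matrix is lost by
   restricting to real roots. *)
Lemma char_poly_eigenvalues n (A : 'M[R]_n) : A^T = A ->
  char_poly A = \prod_(x <- eigenvalues A) ('X - x%:P).
Proof.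
move=> /sym_char_poly_split[s sE]; rewrite sE; apply: perm_big.
apply/allP => x _ /=; apply/eqP.
by rewrite count_eigenvalues sE mu_prod_XsubC.
Qed.

Lemma size_eigenvalues n (A : 'M[R]_n) : A^T = A -> size (eigenvalues A) = n.
Proof.
move=> /char_poly_eigenvalues/(congr1 (fun p : {poly R} => size p)).
by rewrite size_char_poly size_prod_XsubC => -[].
Qed.

End Spectrum.

(* Main.v *)
(** Let [m] be the number of edges and [t] the trace of [A^3] for the adjacency
matrix [A]. Since [t >= 0], twice the positive 3-energy, which is
[sum |lambda|^3 + t], is at least [sum |lambda|^3]; the latter is bounded below
through [sum lambda^2 = 2m] and [m >= n - 1], by the tangent inequality
[2|x|^3 >= 3cx^2 - c^3]. This suffices if [m >= n] or [n >= 7]. For smaller trees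
one adds the fourth moment, [tr A^4 >= 2 sum deg^2 - 2m] with
[sum deg^2 >= 6m - 2n], and a quartic minorant of [|x|^3] gives [n = 5, 6]. For
[n = 4], [m = 3], [t = 0] the spectrum is [a, -a, b, -b] with [a^2 + b^2 = 3] and
[a^4 + b^4 >= 7], hence [(|a|^3 + |b|^3)^2 >= 20], with equality for the path [P_4]. *)

Require Import Defs.
From mathcomp Require Import all_boot all_order all_algebra.
From mathcomp Require Import reals complex zify ring lra.
Import Order.TTheory GRing.Theory Num.Theory.
Local Open Scope ring_scope.

Set Implicit Arguments.
Unset Strict Implicit.
Unset Printing Implicit Defensive.

(** * Power sums of eigenvalues as traces *)

Lemma char_poly_conj (F : fieldType) n (P D : 'M[F]_n) : P \in unitmx ->
  char_poly (invmx P *m D *m P) = char_poly D.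
Proof.
move=> PU; rewrite /char_poly /char_poly_mx.
set Q := map_mx (@polyC F) P; set Q' := map_mx (@polyC F) (invmx P).
have Q'Q : Q' *m Q = 1%:M by rewrite -map_mxM mulVmx // map_mx1.
have -> : 'X%:M - map_mx polyC (invmx P *m D *m P)
        = Q' *m ('X%:M - map_mx polyC D) *m Q.
  by rewrite !map_mxM mulmxBr mulmxBl mul_mx_scalar -scalemxAl Q'Q scalemx1.
by rewrite !det_mulmx mulrC mulrA -det_mulmx (mulmx1C Q'Q) det1 mul1r.
Qed.

Lemma tr_iter_mulmx_diag (F : comNzRingType) n (P Q : 'M[F]_n) (d : 'rV_n) k :
  P *m Q = 1%:M ->
  \tr (iter k (mulmx (Q *m diag_mx d *m P)) 1%:M) = \sum_i d 0 i ^+ k.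
Proof.
move=> PQ.
have -> : iter k (mulmx (Q *m diag_mx d *m P)) 1%:M
        = Q *m diag_mx (\row_i (d 0 i ^+ k)) *m P.
  elim: k => [|k IH].
    have -> : diag_mx (\row_i (d 0 i ^+ 0)) = 1%:M.
      by apply/matrixP => i j; rewrite !mxE expr0.
    by rewrite mulmx1 (mulmx1C PQ).
  rewrite iterS IH !mulmxA; congr (_ *m _).
  rewrite -(mulmxA _ P Q) PQ mulmx1 -mulmxA mulmx_diag; congr (_ *m diag_mx _).
  by apply/rowP => i; rewrite !mxE exprS.
rewrite mxtrace_mulC mulmxA PQ mul1mx mxtrace_diag.
by apply: eq_bigr => i _; rewrite mxE.
Qed.

Lemma sum_eigenvalues_expr (R : rcfType) n (A : 'M[R]_n) k : A^T = A ->
  \sum_(x <- eigenvalues A) x ^+ k = \tr (iter k (mulmx A) 1%:M).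
Proof.
move=> As; pose B : 'M[R[i]]_n := map_mx (real_complex R) A.
have /hermitian_normalmx/orthomx_spectralP BE : B \is hermsymmx.
  apply: realsym_hermsym.
    by apply/is_hermitianmxP; rewrite expr0 scale1r map_mx_id // /B map_trmx As.
  by apply/mxOverP => i j; rewrite mxE complex_real.
have PU := spectral_unit B.
move: (spectralmx B) (spectral_diag B) BE PU => P d BE PU.
(* Both lists are the roots of the characteristic polynomial of [B], so multiplicities agree. *)
have pE : perm_eq [seq d 0 i | i : 'I_n] [seq x%:C%C | x <- eigenvalues A].
  apply/allP => x _ /=; rewrite -!mu_prod_XsubC big_image big_map /=.
  have /(congr1 (map_poly (real_complex R))) := char_poly_eigenvalues As.
  rewrite map_char_poly -/B {1}BE char_poly_conj //.
  rewrite char_poly_trig ?diag_mx_is_trig // rmorph_prod /=.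
  under eq_bigr do rewrite mxE eqxx mulr1n.
  under [in RHS]eq_bigr do rewrite map_polyXsubC.
  by move=> <-.
apply: complexI; rewrite rmorph_sum /=.
transitivity (\sum_(y <- [seq x%:C%C | x <- eigenvalues A]) y ^+ k).
  by rewrite big_map; apply: eq_bigr => x _; rewrite rmorphXn.
rewrite -(perm_big _ pE) big_image /=.
rewrite -(@tr_iter_mulmx_diag _ _ P (invmx P)) ?mulmxV // -BE -trace_map_mx.
congr (\tr _); elim: k => [|k IH] /=; first by rewrite map_mx1.
by rewrite map_mxM -IH.
Qed.

(** * Degrees and short walks *)

Definition deg (V : finType) (G : sgraph V) (x : V) : nat := \sum_y adj G x y.

Definition walk2 (V : finType) (G : sgraph V) (x y : V) : nat :=
  \sum_z adj G x z * adj G z y.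

Lemma walk2xx (V : finType) (G : sgraph V) x : walk2 G x x = deg G x.
Proof.
by apply: eq_bigr => z _; rewrite [adj G z x]adj_sym mulnn; case: adj.
Qed.

Lemma walk2_sym (V : finType) (G : sgraph V) x y : walk2 G x y = walk2 G y x.
Proof.
by apply: eq_bigr => z _; rewrite mulnC [adj G z y]adj_sym [adj G x z]adj_sym.
Qed.

(** Sort the 2-walks by their middle vertex [z]: each end is chosen in [deg G z] ways. *)
Lemma sum_walk2 (V : finType) (G : sgraph V) :
  (\sum_x \sum_y walk2 G x y = \sum_x deg G x ^ 2)%N.
Proof.
under eq_bigr do rewrite exchange_big.
rewrite exchange_big; apply: eq_bigr => z _ /=.
under eq_bigr do rewrite -big_distrr /=.
rewrite -big_distrl /= -mulnn; congr (_ * _)%N.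
by apply: eq_bigr => x _; rewrite adj_sym.
Qed.

(* A square of an integer is at least that integer: keep the square only on the
   diagonal, where the number of 2-walks is the degree. *)
Lemma sum_walk2_sqr (V : finType) (G : sgraph V) :
  (2 * \sum_x deg G x ^ 2 <= \sum_x \sum_y walk2 G x y ^ 2 + \sum_x deg G x)%N.
Proof.
rewrite mul2n -addnn -{1}sum_walk2 -!big_split /=; apply: leq_sum => x _.
rewrite (bigD1 x) //= [in leqRHS](bigD1 x) //= !walk2xx.
have : (\sum_(y | y != x) walk2 G x y <= \sum_(y | y != x) walk2 G x y ^ 2)%N.
  by apply: leq_sum => y _; rewrite -mulnn; case: walk2 => // k; rewrite leq_pmulr.
lia.
Qed.

(** Sum of [(d - 1)(d - 2) >= 0], valid for every integer [d]. *)
Lemma sum_deg_sqr (V : finType) (G : sgraph V) :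
  (3 * \sum_x deg G x <= \sum_x deg G x ^ 2 + 2 * #|V|)%N.
Proof.
rewrite -sum1_card !big_distrr -big_split /=; apply: leq_sum => x _.
by case: (deg G x) => [|[|[|k]]] //; rewrite -mulnn; lia.
Qed.

(** This is the trace of the cubed adjacency matrix, six times the number of triangles. *)
Definition closed_walk3 (V : finType) (G : sgraph V) : nat :=
  \sum_x \sum_y adj G x y * walk2 G y x.

(** * Spectral moments as walk counts *)

Section Traces.
Variables (R : rcfType) (V : finType) (G : sgraph V).
Let A := adjacency_mx R G.

Lemma sum_ord_enum_val (F : V -> R) :
  \sum_(i < #|V|) F (enum_val i) = \sum_x F x.
Proof. by rewrite [RHS]big_enum_val. Qed.

Lemma adjacency_sqr i j : (A *m A) i j = (walk2 G (enum_val i) (enum_val j))%:R.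
Proof.
rewrite mxE natr_sum -sum_ord_enum_val.
by apply: eq_bigr => k _; rewrite !mxE natrM.
Qed.

Lemma sum_eigenvalues : \sum_(x <- eigenvalues A) x = 0.
Proof.
rewrite (eq_bigr (fun x => x ^+ 1)) //.
rewrite sum_eigenvalues_expr ?adjacency_mx_sym //= mulmx1.
by apply: big1 => i _; rewrite mxE adj_irrefl.
Qed.

Lemma sum_eigenvalues_expr2 :
  \sum_(x <- eigenvalues A) x ^+ 2 = (\sum_x deg G x)%:R.
Proof.
rewrite sum_eigenvalues_expr ?adjacency_mx_sym //= mulmx1 natr_sum.
rewrite -sum_ord_enum_val; apply: eq_bigr => i _.
by rewrite adjacency_sqr walk2xx.
Qed.

Lemma sum_eigenvalues_expr3 :
  \sum_(x <- eigenvalues A) x ^+ 3 = (closed_walk3 G)%:R.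
Proof.
rewrite sum_eigenvalues_expr ?adjacency_mx_sym //= mulmx1 natr_sum.
rewrite -sum_ord_enum_val; apply: eq_bigr => i _.
rewrite mxE natr_sum -sum_ord_enum_val; apply: eq_bigr => j _.
by rewrite adjacency_sqr mxE natrM.
Qed.

Lemma sum_eigenvalues_expr4 :
  \sum_(x <- eigenvalues A) x ^+ 4 = (\sum_x \sum_y walk2 G x y ^ 2)%:R.
Proof.
rewrite sum_eigenvalues_expr ?adjacency_mx_sym //= mulmx1 mulmxA natr_sum.
rewrite -sum_ord_enum_val; apply: eq_bigr => i _.
rewrite mxE natr_sum -sum_ord_enum_val; apply: eq_bigr => j _.
by rewrite !adjacency_sqr (walk2_sym G (enum_val j)) natrX.
Qed.

(** [|x|^3 + x^3] is [2|x|^3] for positive [x] and vanishes otherwise. *)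
Lemma positive_energy3E :
  2 * positive_energy R 3 G
  = \sum_(x <- eigenvalues A) `|x| ^+ 3 + (closed_walk3 G)%:R.
Proof.
rewrite -sum_eigenvalues_expr3 -big_split /= /positive_energy mulr_sumr.
rewrite big_mkcond /=; apply: eq_bigr => x _.
by case: ltrP => [x0|x0]; rewrite ?(gtr0_norm x0) ?(ler0_norm x0); ring.
Qed.

End Traces.

(** * Edge count of connected graphs *)

Lemma edge_out (V : finType) (G : sgraph V) (S : {set V}) :
  connected_graph G -> S != set0 -> S != setT ->
  exists x y, [/\ x \in S, y \notin S & adj G x y].
Proof.
move=> Gc /set0Pn[x xS] ST.
case: (pickP [pred u : V * V | [&& u.1 \in S, u.2 \notin S & adj G u.1 u.2]]).
  by case=> u v /= /and3P[]; exists u, v.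
(* Without such an edge [S] is closed under adjacency, so by connectedness it is everything. *)
move=> no; case/negP: ST; apply/eqP/setP => y; rewrite !inE -xS; apply: esym.
have sym : connect_sym (adj G) by apply: sym_connect_sym; exact: adj_sym.
apply: (closed_connect _ (Gc x y)); apply: (intro_closed sym) => u v uv uS.
by move: (no (u, v)); rewrite /= uS uv andbT /= => /negbFE.
Qed.

Lemma connected_sum_deg (V : finType) (G : sgraph V) :
  connected_graph G -> (2 * #|V|.-1 <= \sum_x deg G x)%N.
Proof.
move=> Gc; have [->//|V0] := posnP #|V|.
(* Grow a vertex set along outgoing edges: each new vertex adds at least one edge, counted in both
   directions. *)
have grow k : (0 < k <= #|V|)%N -> exists S : {set V}, #|S| = k /\
    (2 * k.-1 <= \sum_(x in S) \sum_(y in S) adj G x y)%N.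
  elim: k => [//|k IH] /= kV; have [k0|k0] := posnP k.
    have [x _] : exists x, x \in V by apply/card_gt0P; rewrite k0 in kV.
    by exists [set x]; rewrite cards1 k0.
  have [S [Sk IHS]] := IH (introT andP (conj k0 (ltnW kV))).
  have [||x [y [xS yS xy]]] := @edge_out _ G S Gc.
  - by rewrite -card_gt0 Sk.
  - by apply: contraTneq kV => ST; rewrite -Sk ST cardsT ltnn.
  exists (y |: S); rewrite cardsU1 yS Sk; split=> //=.
  rewrite big_setU1 //=.
  have E u : (\sum_(v in y |: S) adj G u v
             = adj G u y + \sum_(v in S) adj G u v)%N by rewrite big_setU1.
  rewrite E (eq_bigr _ (fun u _ => E u)) big_split /=.
  have H1 : (0 < \sum_(v in S) adj G y v)%N by rewrite (bigD1 x) //= adj_sym xy.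
  have H2 : (0 < \sum_(v in S) adj G v y)%N by rewrite (bigD1 x) //= xy.
  by lia.
have [|S [SV H]] := grow #|V|; first by rewrite V0 leqnn.
have ST : S = setT by apply/eqP; rewrite eqEcard subsetT cardsT SV leqnn.
apply: leq_trans H _; rewrite ST (eq_bigl predT) => [|x]; last by rewrite inE.
by apply: leq_sum => x _; rewrite (eq_bigl predT) => [|y]; rewrite ?inE.
Qed.

(** * Lower bounds for sums of absolute cubes *)

Section RealInequalities.
Variable R : rcfType.
Implicit Types (c x y u w : R) (s : seq R).

Lemma cube_ge_tangent c x : 0 <= c -> 3 * c * x ^+ 2 - c ^+ 3 <= 2 * `|x| ^+ 3.
Proof.
move=> c0; rewrite -[x ^+ 2]real_normK ?num_real //.
move: `|x| (normr_ge0 x) => y y0; rewrite -subr_ge0.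
have -> : 2 * y ^+ 3 - (3 * c * y ^+ 2 - c ^+ 3) = (y - c) ^+ 2 * (2 * y + c).
  by ring.
by rewrite mulr_ge0 ?sqr_ge0 // addr_ge0 // mulr_ge0.
Qed.

(* The minorant is [1 + 3/2 (x^2 - 1) + 1/5 (x^2 - 1)^2],
   tangent to [|x|^3] at [|x| = 1]. *)
Lemma cube_ge_quartic x : x ^+ 2 <= 11 ->
  1 / 5 * x ^+ 4 + 11 / 10 * x ^+ 2 - 3 / 10 <= `|x| ^+ 3.
Proof.
have -> : x ^+ 4 = (x ^+ 2) ^+ 2 by ring.
rewrite -[x ^+ 2]real_normK ?num_real //.
move: `|x| (normr_ge0 x) => y y0 y11; rewrite -subr_ge0.
have -> : y ^+ 3 - (1 / 5 * (y ^+ 2) ^+ 2 + 11 / 10 * y ^+ 2 - 3 / 10)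
        = (y - 1) ^+ 2 * (1 / 5 * (3 * y + 3 / 2 - y ^+ 2)) by field.
(* The last factor is nonnegative up to [y = (3 + sqrt 15)/2], which exceeds [sqrt 11]. *)
by apply: mulr_ge0; [exact: sqr_ge0|have [|] := lerP y 3; nra].
Qed.

Lemma sum_cube_ge_tangent c s : 0 <= c ->
  3 * c * (\sum_(x <- s) x ^+ 2) - (size s)%:R * c ^+ 3
  <= 2 * \sum_(x <- s) `|x| ^+ 3.
Proof.
move=> c0; elim: s => [|x s IH] /=; first by rewrite !big_nil mul0r !mulr0 subr0.
by rewrite !big_cons -[(size s).+1%:R]natr1; have := cube_ge_tangent x c0; lra.
Qed.

(** The bound on the sum bounds each square. The value 11 is the largest degree sum below [2n] for
    [n <= 6]. *)
Lemma sum_cube_ge_quartic s : \sum_(x <- s) x ^+ 2 <= 11 ->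
  1 / 5 * (\sum_(x <- s) x ^+ 4) + 11 / 10 * (\sum_(x <- s) x ^+ 2)
    - 3 / 10 * (size s)%:R
  <= \sum_(x <- s) `|x| ^+ 3.
Proof.
have sq0 (t : seq R) : 0 <= \sum_(x <- t) x ^+ 2 by apply: sumr_ge0 => x _; exact: sqr_ge0.
elim: s => [|x s IH]; first by rewrite !big_nil !mulr0 subr0 addr0.
rewrite !big_cons /= -[(size s).+1%:R]natr1 => s11.
have /IH {}IH : \sum_(x <- s) x ^+ 2 <= 11 by have := sqr_ge0 x; lra.
have : x ^+ 2 <= 11 by have := sq0 s; lra.
by move=> /cube_ge_quartic; have := IH; lra.
Qed.

(** With [k = |uw|] the hypotheses give [9 - 2k^2 >= 7], so [k <= 1], and the squared right-hand
    side is [27 - 9k^2 + 2k^3], which is 20 at [k = 1]. *)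
Lemma sum_cube2_ge u w :
  u ^+ 2 + w ^+ 2 = 3 -> 7 <= u ^+ 4 + w ^+ 4 ->
  2 * Num.sqrt 5 <= `|u| ^+ 3 + `|w| ^+ 3.
Proof.
have E z : z ^+ 4 = (z ^+ 2) ^+ 2 :> R by ring.
rewrite !E -[u ^+ 2]real_normK ?num_real // -[w ^+ 2]real_normK ?num_real //.
move: `|u| `|w| (normr_ge0 u) (normr_ge0 w) => {}u {}w u0 w0 uw2 uw4.
have k0 : 0 <= u * w by rewrite mulr_ge0.
have k1 : u * w <= 1 by nra.
rewrite -(@ler_pXn2r _ 2) ?nnegrE ?mulr_ge0 ?sqrtr_ge0 ?addr_ge0 ?exprn_ge0 //.
rewrite exprMn sqr_sqrtr //.
have -> : (u ^+ 3 + w ^+ 3) ^+ 2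
  = (u ^+ 2 + w ^+ 2) ^+ 3 - 3 * (u * w) ^+ 2 * (u ^+ 2 + w ^+ 2)
    + 2 * (u * w) ^+ 3 by ring.
rewrite uw2; move: (u * w) k0 k1 => k k0 k1; rewrite -subr_ge0.
have -> : 3 ^+ 3 - 3 * k ^+ 2 * 3 + 2 * k ^+ 3 - 2 ^+ 2 * 5
        = (1 - k) * (7 + 7 * k - 2 * k ^+ 2) by ring.
by rewrite mulr_ge0 ?subr_ge0 //; nra.
Qed.

(* Since [(a+b+c)^3 = a^3+b^3+c^3 + 3(a+b)(b+c)(c+a)], four numbers with
   vanishing sum and sum of cubes split into two opposite pairs. *)
Lemma sum_cube4_ge s : size s = 4 ->
  \sum_(x <- s) x = 0 -> \sum_(x <- s) x ^+ 3 = 0 ->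
  \sum_(x <- s) x ^+ 2 = 6 -> 14 <= \sum_(x <- s) x ^+ 4 ->
  4 * Num.sqrt 5 <= \sum_(x <- s) `|x| ^+ 3.
Proof.
case: s => [|a [|b [|c [|d []]]]] // _; rewrite !big_cons !big_nil !addr0.
move=> s1 s3 s2 s4.
have dE : d = - (a + b + c) by lra.
have : (a + b) * (b + c) * (c + a) = 0 by move: s3; rewrite dE; lra.
move/eqP; rewrite !mulf_eq0 -orbA => /or3P[]/eqP h.
- have bE : b = - a by lra.
  have {}dE : d = - c by lra.
  move: s2 s4; rewrite bE dE !normrN => s2 s4.
  by have := @sum_cube2_ge a c; lra.
- have cE : c = - b by lra.
  have {}dE : d = - a by lra.
  move: s2 s4; rewrite cE dE !normrN => s2 s4.
  by have := @sum_cube2_ge a b; lra.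
- have cE : c = - a by lra.
  have {}dE : d = - b by lra.
  move: s2 s4; rewrite cE dE !normrN => s2 s4.
  by have := @sum_cube2_ge a b; lra.
Qed.

End RealInequalities.

(** * Connected graphs on two and three vertices *)

Section SmallGraphs.
Variables (V : finType) (G : sgraph V).

Lemma complete_graph_iso m : #|V| = m ->
  (forall x y, x != y -> adj G x y) -> graph_iso G (complete_graph m).
Proof.
move=> <- Gc; exists enum_rank; first exact: enum_rank_bij.
move=> x y /=; rewrite (inj_eq enum_rank_inj).
by have [->|/Gc->//] := eqVneq x y; rewrite adj_irrefl.
Qed.

Lemma connected_neighbor x : connected_graph G -> (1 < #|V|)%N ->
  exists2 y, y != x & adj G x y.
Proof.
move=> Gc V1; have [||u [y [/set1P-> yx uy]]] := @edge_out _ G [set x] Gc.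
- by apply/set0Pn; exists x; rewrite inE.
- by apply: contraTneq V1 => xT; rewrite -cardsT -xT cards1.
by exists y => //; rewrite inE in yx.
Qed.

Lemma connected_card2_iso : connected_graph G -> #|V| = 2 ->
  graph_iso G (complete_graph 2).
Proof.
move=> Gc V2; apply: complete_graph_iso => // x y xy.
have [|z zx xz] := connected_neighbor x Gc; first by rewrite V2.
suff -> : y = z by [].
apply/eqP; apply: contraT => yz.
have : uniq [:: x; y; z] by rewrite /= !inE negb_or xy yz eq_sym zx.
by move/card_uniqP => /= c3; have := max_card (mem [:: x; y; z]); rewrite c3 V2.
Qed.

(** Degree sum 6 is forced if all pairs are adjacent, so some [x], [y] are not; the third vertex [z]
    is then the neighbor of both, and the middle of the path. *)
Lemma connected_card3_iso : connected_graph G -> #|V| = 3 ->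
  (\sum_x deg G x < 6)%N -> graph_iso G (path_graph 3).
Proof.
move=> Gc V3 lt6.
have [x [y [xy nxy]]] : exists x y, x != y /\ ~~ adj G x y.
  case: (pickP [pred u : V * V | (u.1 != u.2) && ~~ adj G u.1 u.2]).
    by case=> x y /= /andP[]; exists x, y.
  move=> no; move: lt6; rewrite ltnNge => /negP[].
  have adjE x y : adj G x y = (y != x).
    have [->|xy] := eqVneq y x; first exact: adj_irrefl.
    by have := no (x, y); rewrite /= eq_sym xy /= => /negbFE.
  have degE x : deg G x = 2.
    have <- : #|predC1 x| = 2 by rewrite cardC1 V3.
    rewrite -sum1_card [RHS]big_mkcond; apply: eq_bigr => y _.
    by rewrite adjE !inE; case: eqP.
  by under eq_bigr do rewrite degE; rewrite sum_nat_const V3.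
have V1 : (1 < #|V|)%N by rewrite V3.
have [z zx xz] := connected_neighbor x Gc V1.
have [t ty yt] := connected_neighbor y Gc V1.
have zy : z != y by apply: contraNneq nxy => <-.
have U : uniq [:: x; z; y] by rewrite /= !inE negb_or xy eq_sym zx zy.
have all_xzy u : u \in [:: x; z; y].
  have : [:: x; z; y] =i V.
    by apply/subset_cardP; [rewrite V3; exact/card_uniqP | exact/subsetP].
  by move=> ->.
have tz : t = z.
  move: (all_xzy t); rewrite !inE (negPf ty) orbF => /orP[/eqP tx|/eqP//].
  by move: yt; rewrite tx adj_sym (negPf nxy).
have {}yz : adj G y z by rewrite -tz.
pose f u : 'I_3 := if u == x then ord0 else if u == z then lift ord0 ord0 else ord_max.
have fx : f x = ord0 by rewrite /f eqxx.
have fz : f z = lift ord0 ord0 by rewrite /f (negPf zx) eqxx.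
have fy : f y = ord_max by rewrite /f eq_sym (negPf xy) eq_sym (negPf zy).
exists f.
  apply: inj_card_bij; last by rewrite card_ord V3.
  move=> u v; move: (all_xzy u) (all_xzy v); rewrite !inE.
  by do 2![case/or3P=> /eqP->]; rewrite ?fx ?fy ?fz // => /(congr1 val).
move=> u v; move: (all_xzy u) (all_xzy v); rewrite !inE.
by do 2![case/or3P=> /eqP->]; rewrite ?fx ?fy ?fz /= /path_adj /= ?adj_irrefl
  ?(negPf nxy) ?xz ?yz // adj_sym ?(negPf nxy) ?xz ?yz.
Qed.

End SmallGraphs.

(** * The bound, by cases on order and degree sum *)

Unset Implicit Arguments.

Theorem theorem1p8 (R : realType) (n : nat) (V : finType) (G : sgraph V)
    (n_gt0 : (0 < n)%N) (card_V : #|V| = n) (G_conn : connected_graph G)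
    (GnK1 : ~ graph_iso G (complete_graph 1))
    (GnK2 : ~ graph_iso G (complete_graph 2))
    (GnP3 : ~ graph_iso G (path_graph 3)) :
  Num.sqrt 5 / 2 * n%:R <= positive_energy R 3 G.
Proof.
have := positive_energy3E R G; set E := positive_energy R 3 G.
set e := eigenvalues _; set S := \sum_(x <- e) `|x| ^+ 3 => EE.
have size_e : size e = n by rewrite size_eigenvalues ?adjacency_mx_sym.
have [t0 t5] : 0 <= Num.sqrt (5 : R) /\ Num.sqrt (5 : R) ^+ 2 = 5.
  by rewrite sqrtr_ge0 sqr_sqrtr.
have t_lt : Num.sqrt (5 : R) <= 2237 / 1000 by nra.
have p1 := sum_eigenvalues R G; have p2 := sum_eigenvalues_expr2 R G.
have p3 := sum_eigenvalues_expr3 R G; have p4 := sum_eigenvalues_expr4 R G.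
rewrite -/e in p1 p2 p3 p4.
have conn := connected_sum_deg G_conn.
have walks := sum_walk2_sqr G; have degs := sum_deg_sqr G.
have iso2 := connected_card2_iso G_conn.
have iso3 := connected_card3_iso G_conn.
rewrite !card_V in conn degs iso2 iso3.
(* From here on [m] is the degree sum, twice the number of edges. *)
move: (\sum_x deg G x)%N (\sum_x deg G x ^ 2)%N
  (\sum_x \sum_y walk2 G x y ^ 2)%N (closed_walk3 G)
  p2 p3 p4 EE conn walks degs iso3 => m d2 w4 w3 p2 p3 p4 EE conn walks degs iso3.
have n0 : 0 <= n%:R :> R by [].
have w30 : 0 <= w3%:R :> R by [].
suff : Num.sqrt 5 * n%:R <= 2 * E by lra.
have [big|small] := boolP ((2 * n <= m) || (7 <= n))%N.
  (* The worst ratio here is [m/n = 12/7]; the best tangent point is its square root, about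
     1.309. *)
  have c0 : 0 <= 13 / 10 :> R by lra.
  have := sum_cube_ge_tangent e c0; rewrite p2 size_e -/S.
  have : 12 * n%:R <= 7 * m%:R :> R by rewrite -!natrM ler_nat; lia.
  by nra.
have {small}[n_lt m_lt] : (n < 7 /\ m < 2 * n)%N by lia.
(* The left side equals [2.1m - 1.1n]. *)
have low : 1 / 5 * (5 * m%:R - 4 * n%:R) + 11 / 10 * m%:R - 3 / 10 * n%:R <= S.
  have w4_ge : 5 * m%:R <= w4%:R + 4 * n%:R :> R.
    by rewrite -!natrM -natrD ler_nat; lia.
  have := @sum_cube_ge_quartic R e; rewrite p2 p4 size_e -/S ler_nat.
  have -> : (m <= 11)%N by lia.
  by move=> /(_ isT); lra.
(* With [m >= 2n - 2], [low] gives [S >= 3.1n - 4.2], which suffices from [n = 5] on. *)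
have [n_large|n_small] := ltnP 4 n.
  have : 2 * n%:R <= m%:R + 2 :> R by rewrite -natrM -natrD ler_nat; lia.
  have : 5 <= n%:R :> R by rewrite ler_nat.
  by nra.
have n1 : n != 1%N.
  apply/eqP => n1; apply: GnK1; apply: complete_graph_iso => [|x y].
    by rewrite card_V.
  by have /fintype_le1P/(_ x y) -> : (#|V| <= 1)%N; rewrite ?eqxx // card_V n1.
have n2 : n != 2 by apply/eqP => /iso2.
(* The odd value is settled numerically: [low] gives [S >= 3.1n - 2.1], enough for [n >= 3].
   Otherwise [m = 2n - 2]. *)
have [m_odd|m_even] := eqVneq m (2 * n - 1)%N.
  have : 2 * n%:R = m%:R + 1 :> R by rewrite -natrM natr1; congr _%:R; lia.
  have : 3 <= n%:R :> R by rewrite ler_nat; lia.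
  by nra.
have n4 : n = 4.
  suff : n != 3 by lia.
  by apply/eqP => n3; apply: GnP3; apply: iso3 => //; lia.
have m6 : m = 6 by lia.
move: low p2 EE; rewrite m6 n4 => low p2 EE.
have [w3_0|w3_pos] := posnP w3.
  move: p3; rewrite w3_0 => p3.
  have := @sum_cube4_ge R e; rewrite size_e p1 p3 p2 p4 n4.
  rewrite ler_nat -/S => /(_ erefl erefl erefl erefl).
  have -> : (14 <= w4)%N by lia.
  by move=> /(_ isT); rewrite w3_0 in EE; lra.
(* Now [low] reads [S >= 8.2], and [8.2 + 1] exceeds [4 sqrt 5], about 8.944. *)
have : 1 <= w3%:R :> R by rewrite ler1n.
by lra.
Qed.
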